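(* Let $(X,p)$ be a complete partial metric space. Suppose that the mapping $F : X\times X \rightarrow X$ satisfies, for all $x,y,u,v\in X$, \[ p(F(x,y),F(u,v))\leq k\,p(F(x,y),x)+l\,p(F(u,v),u), \] where $k,l$ are nonnegative real constants with $k+l<1$. Then $F$ has a unique coupled fixed point.
   Context: A partial metric on a nonempty set $X$ is a function $p:X\times X\to[0,+\infty)$ such that for all $x,y,z\in X$: (p1) $x=y$ if and only if $p(x,x)=p(x,y)=p(y,y)$; (p2) $p(x,x)\leq p(x,y)$; (p3) $p(x,y)=p(y,x)$; (p4) $p(x,y)\leq p(x,z)+p(z,y)-p(z,z)$. A partial metric space is a pair $(X,p)$ with $X$ a nonempty set and $p$ a partial metric on $X$. A sequence $\{x_n\}$ in $X$ converges to $x\in X$ if $p(x,x)=\lim_{n\to+\infty}p(x,x_n)$. A sequence $\{x_n\}$ is Cauchy if $\lim_{n,m\to+\infty}p(x_n,x_m)$ exists and is finite. $(X,p)$ is complete if every Cauchy sequence $\{x_n\}$ in $X$ converges to a point $x\in X$ with $p(x,x)=\lim_{n,m\to+\infty}p(x_n,x_m)$. A coupled fixed point of $F:X\times X\to X$ is an element $(x,y)\in X\times X$ with $F(x,y)=x$ and $F(y,x)=y$. *)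

(* Defs.v *)
From mathcomp Require Import all_boot all_order all_algebra.
From mathcomp Require Import all_classical all_reals all_analysis.

Set Implicit Arguments.
Unset Strict Implicit.
Unset Printing Implicit Defensive.

Import Order.TTheory GRing.Theory Num.Theory.
Import numFieldNormedType.Exports.

Local Open Scope classical_set_scope.
Local Open Scope ring_scope.

Record is_partial_metric (R : realType) (X : Type) (p : X * X -> R) : Prop := {
  pm_ge0 : forall x y : X, 0 <= p (x, y);
  pm_eq : forall x y : X,
    x = y <-> (p (x, x) = p (x, y) /\ p (x, y) = p (y, y));
  pm_le : forall x y : X, p (x, x) <= p (x, y);
  pm_sym : forall x y : X, p (x, y) = p (y, x);
  pm_tri : forall x y z : X, p (x, y) <= p (x, z) + p (z, y) - p (z, z)
}.

Definition pm_converges (R : realType) (X : Type) (p : X * X -> R)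
    (u : nat -> X) (x : X) : Prop :=
  p (x, u n) @[n --> \oo] --> p (x, x).

(* [lim_(n, m -> +oo) p (u n, u m) = a], both indices going to infinity
   independently; as [a : R], this limit is finite. *)
Definition pm_double_limit (R : realType) (X : Type) (p : X * X -> R)
    (u : nat -> X) (a : R) : Prop :=
  p (u nm.1, u nm.2) @[nm --> (\oo, \oo)] --> a.

Definition pm_cauchy (R : realType) (X : Type) (p : X * X -> R)
    (u : nat -> X) : Prop :=
  exists a : R, pm_double_limit p u a.

Definition pm_complete (R : realType) (X : Type) (p : X * X -> R) : Prop :=
  forall u : nat -> X, pm_cauchy p u ->
    exists x : X, pm_converges p u x /\ pm_double_limit p u (p (x, x)).

Definition coupled_fixed_point (X : Type) (F : X * X -> X) (z : X * X) : Prop :=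
  F (z.1, z.2) = z.1 /\ F (z.2, z.1) = z.2.

(* Main.v *)
Require Import Defs.
From mathcomp Require Import all_boot all_order all_algebra.
From mathcomp Require Import all_classical all_reals all_analysis.
From mathcomp Require Import lra.

(** The contraction condition has the form of Kannan's, and restricting [F] to
the diagonal gives a self-map [T x = F (x, x)] satisfying Kannan's condition
[p (T x, T u) <= k p (T x, x) + l p (T u, u)].  A fixed point [x] of [T] is the
same thing as a coupled fixed point [(x, x)] of [F], so existence only needs
Kannan's theorem in a complete partial metric space
([kannan_fixed_point]).  There, the consecutive distances along an orbit of [T]
decay geometrically with ratio [l / (1 - k)] ([kannan_orbit_decay]), and the
condition itself bounds the distance of any two points of the orbit by
consecutive ones; hence the orbit is Cauchy with double limit [0], its limit [x]
has self-distance [0], and passing to the limit gives [p (T x, x) = 0].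

Uniqueness uses the condition for [F] itself: at coupled fixed points it bounds
[p (x, u)] by self-distances, which are at most [p (x, u)], so the factor
[k + l < 1] forces [p (x, u) = 0].  Distance [0] implies equality. *)

Import Order.TTheory GRing.Theory Num.Theory.
Import numFieldNormedType.Exports.

Local Open Scope ring_scope.

Lemma partial_metric_eq0 (R : realType) (X : Type) (p : X * X -> R) (x y : X) :
  is_partial_metric p -> p (x, y) = 0 -> x = y.
Proof.
move=> hp pxy0; apply/(pm_eq hp).
have pxx := pm_le hp x y; have pyy := pm_le hp y x.
have pxx0 := pm_ge0 hp x x; have pyy0 := pm_ge0 hp y y.
rewrite (pm_sym hp y x) in pyy; split; lra.
Qed.

Section Kannan.
Local Open Scope classical_set_scope.
Local Open Scope ring_scope.
Context (R : realType) (X : Type) (p : X * X -> R) (T : X -> X) (k l : R).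
Hypotheses (hp : is_partial_metric p) (hl : 0 <= l) (hkl : k + l < 1).
Hypothesis hT : forall x u, p (T x, T u) <= k * p (T x, x) + l * p (T u, u).

Lemma one_sub_k_gt0 : 0 < 1 - k.
Proof. by rewrite subr_gt0; apply: le_lt_trans hkl; rewrite lerDl. Qed.

(** Applied to two consecutive points, the condition has the new distance on
both sides; solving for it yields the ratio [l / (1 - k)]. *)
Lemma kannan_orbit_decay (x0 : X) (n : nat) :
  p (iter n.+1 T x0, iter n T x0) <= (l / (1 - k)) ^+ n * p (T x0, x0).
Proof.
have k1 := one_sub_k_gt0.
elim: n => [|n IHn]; first by rewrite expr0 mul1r.
rewrite exprS -mulrA; apply: le_trans (ler_wpM2l _ IHn); last first.
  by apply: divr_ge0 => //; exact: ltW.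
rewrite mulrAC ler_pdivlMr //.
have := hT (iter n.+1 T x0) (iter n T x0); rewrite -!iterS; lra.
Qed.

Lemma kannan_orbit_cvg0 (x0 : X) :
  p (iter n.+1 T x0, iter n T x0) @[n --> \oo] --> (0 : R).
Proof.
have k1 := one_sub_k_gt0.
apply: (@squeeze_cvgr _ _ _ _ (fun=> 0)
  (fun n => (l / (1 - k)) ^+ n * p (T x0, x0))).
- by apply: nearW => n; rewrite (pm_ge0 hp) kannan_orbit_decay.
- exact: cvg_cst.
- rewrite -[X in _ --> X](mul0r (p (T x0, x0))).
  apply: cvgM; last exact: cvg_cst.
  apply: cvg_expr; rewrite ger0_norm ?divr_ge0 ?(ltW k1) //.
  by rewrite ltr_pdivrMr // mul1r ltrBrDl.
Qed.

(** The condition bounds the distance of two iterates directly by the two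
preceding consecutive distances, so no geometric series is summed.  The orbit
starts at [T x0] in order that every term be a value of [T]. *)
Lemma kannan_orbit_double_limit (x0 : X) :
  pm_double_limit p (fun n => iter n.+1 T x0) 0.
Proof.
have d0 := kannan_orbit_cvg0 x0.
apply: (@squeeze_cvgr _ _ _ _ (fun=> 0) (fun nm : nat * nat =>
  k * p (iter nm.1.+1 T x0, iter nm.1 T x0) +
  l * p (iter nm.2.+1 T x0, iter nm.2 T x0))).
- by apply: nearW => -[n m]; rewrite (pm_ge0 hp) /= hT.
- exact: cvg_cst.
- have -> : (0 : R) = k * 0 + l * 0 by rewrite !mulr0 addr0.
  apply: cvgD; apply: cvgMl_tmp.
  + exact: (cvg_comp _ _ cvg_fst d0).
  + exact: (cvg_comp _ _ cvg_snd d0).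
Qed.

Lemma kannan_fixed_point :
  inhabited X -> pm_complete p -> exists x, T x = x.
Proof.
move=> [x0] hcomplete.
have u0 := kannan_orbit_double_limit x0.
have [x [ux uxx]] := hcomplete _ (ex_intro _ _ u0).
have pxx : p (x, x) = 0 by exact: (cvg_unique _ uxx u0).
exists x; apply: (partial_metric_eq0 _ _ _ _ _ hp).
suff : (1 - k) * p (T x, x) <= 0.
  have := pm_ge0 hp (T x) x => Tx0 Tx1; apply/eqP; rewrite eq_le Tx0 andbT.
  by move: Tx1; rewrite pmulr_rle0 // one_sub_k_gt0.
have lim0 : l * p (iter n.+1 T x0, iter n T x0) + p (x, iter n.+1 T x0)
    @[n --> \oo] --> (0 : R).
  have -> : (0 : R) = l * 0 + p (x, x) by rewrite pxx mulr0 addr0.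
  by apply: cvgD => //; apply: cvgMl_tmp; exact: kannan_orbit_cvg0.
rewrite -(cvg_lim _ lim0) //; apply: limr_ge; first by apply/cvg_ex; exists 0.
apply: nearW => n.
(* Triangle inequality through the (n+1)-st iterate, the condition applied to
   the first summand. *)
have := pm_tri hp (T x) x (iter n.+1 T x0).
have := hT x (iter n T x0); rewrite -iterS.
have := pm_ge0 hp (iter n.+1 T x0) (iter n.+1 T x0).
rewrite (pm_sym hp (iter n.+1 T x0) x); lra.
Qed.

End Kannan.

(** The two coupled fixed points enter only through the two equations for the
coordinates compared, which makes the lemma usable for either coordinate. *)
Lemma coupled_coordinate_unique (R : realType) (X : Type) (p : X * X -> R)
    (F : X * X -> X) (k l : R) (x y u v : X) :
  is_partial_metric p -> 0 <= k -> 0 <= l -> k + l < 1 ->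
  (forall x y u v : X,
     p (F (x, y), F (u, v)) <= k * p (F (x, y), x) + l * p (F (u, v), u)) ->
  F (x, y) = x -> F (u, v) = u -> x = u.
Proof.
move=> hp hk hl hkl hF Fx Fu; apply: (partial_metric_eq0 _ _ _ _ _ hp).
have := hF x y u v; rewrite Fx Fu.
have := ler_wpM2l hk (pm_le hp x u).
have := ler_wpM2l hl (pm_le hp u x); rewrite (pm_sym hp u x).
have := pm_ge0 hp x u => pxu0 lu kx pxu.
have : (1 - (k + l)) * p (x, u) <= 0 by lra.
by rewrite pmulr_rle0 => [pxu1|]; lra.
Qed.

Theorem theorem2p4 (R : realType) (X : Type) (p : X * X -> R) (F : X * X -> X)
    (k l : R)
    (hX : inhabited X)
    (hp : is_partial_metric p)
    (hcomplete : pm_complete p)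
    (hk : 0 <= k) (hl : 0 <= l) (hkl : k + l < 1)
    (hF : forall x y u v : X,
       p (F (x, y), F (u, v)) <= k * p (F (x, y), x) + l * p (F (u, v), u)) :
  exists! z : X * X, coupled_fixed_point F z.
Proof.
have [x Fx] : exists x, F (x, x) = x.
  exact: (kannan_fixed_point _ _ p (fun x => F (x, x)) k l).
exists (x, x); split => [//|[u v] [/= Fu Fv]].
have unique a b c d :=
  coupled_coordinate_unique _ _ p F k l a b c d hp hk hl hkl hF.
by rewrite -(unique x x u v Fx Fu) -(unique x x v u Fx Fv).
Qed.
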